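(* Let $k$ be a field. Any nonabelian solvable group $G$ has an element $g$ which commutes with a conjugate $h^{-1}gh\neq g$ (for some $h\in G$); hence its group algebra $k\,G$ contains a trinomial element which generates the improper ideal.
   Context: A trinomial is an element of $k\,G$ whose support (the set of group elements having nonzero coefficient in it) has cardinality $3$. ''Ideal'' means two-sided ideal; an element generates the improper ideal if the two-sided ideal it generates is all of $k\,G$. *)

(* Defs.v *)
From HB Require Import structures.
From mathcomp Require Import all_boot all_algebra finmap.
From mathcomp.multinomials Require Import monalg.
From mathcomp Require Import classical_sets.

Set Implicit Arguments.
Unset Strict Implicit.
Unset Printing Implicit Defensive.

Import GRing.Theory.
Local Open Scope classical_set_scope.
Local Open Scope fset_scope.
Local Open Scope ring_scope.

(* [groupType] is the library's structure of possibly infinite groups. It has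
   no theory of subgroups and no notion of solvability (those are restricted to
   [finGroupType]), so subgroups are represented as subsets [H : set G]. *)
Section Solvable.
Variable G : groupType.
Local Open Scope group_scope.

Definition subgroup (H : set G) : Prop :=
  [/\ H 1, forall x y, H x -> H y -> H (x * y) & forall x, H x -> H x^-1].

Definition derived_subgroup (H : set G) : set G :=
  smallest subgroup [set z | exists x y, [/\ H x, H y & z = [~ x, y]]].

Definition derived_series (n : nat) : set G := iter n derived_subgroup setT.

Definition solvable_group : Prop := exists n, derived_series n = [set 1].

Definition abelian_group : Prop := forall x y : G, commute x y.

End Solvable.

(* [{malg k[G]}] is the type of finitely supported functions [G -> k] with its
   k-module structure; the library gives it a product only when [G] is a monoid
   without nontrivial invertible elements. *)
Section GroupAlgebraTheory.
Variables (k : fieldType) (G : groupType).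

Implicit Types (x y z : {malg k[G]}) (g h : G).

Local Notation U c g := (<< c *g g >> : {malg k[G]}).

Definition galg_one : {malg k[G]} := U 1 1%g.

Definition galg_mul x y : {malg k[G]} :=
  \sum_(g <- msupp x) \sum_(h <- msupp y) U (x@_g * y@_h) (g * h)%g.

Lemma galg_mulw (d1 d2 : {fset G}) x y :
    msupp x `<=` d1 -> msupp y `<=` d2 ->
  galg_mul x y = \sum_(g <- d1) \sum_(h <- d2) U (x@_g * y@_h) (g * h)%g.
Proof.
move=> le1 le2; rewrite /galg_mul (big_fset_incl _ le1) /=.
  apply/eq_bigr => g _; apply/big_fset_incl => // h _ /mcoeff_outdom ->.
  by rewrite mulr0 monalgU0.
move=> g _ /mcoeff_outdom xg; rewrite big1 // => h _.
by rewrite xg mul0r monalgU0.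
Qed.

Lemma galg_mulUU (a b : k) g h :
  galg_mul (U a g) (U b h) = U (a * b) (g * h)%g.
Proof. by rewrite (galg_mulw msuppU_le msuppU_le) !big_seq_fset1 !mcoeffUU. Qed.

Lemma galg_mulDl : left_distributive galg_mul +%R.
Proof.
move=> x y z.
rewrite (galg_mulw (msuppD_le x y) (fsubset_refl (msupp z))).
rewrite (galg_mulw (fsubsetUl (msupp x) (msupp y)) (fsubset_refl (msupp z))).
rewrite (galg_mulw (fsubsetUr (msupp x) (msupp y)) (fsubset_refl (msupp z))).
rewrite -big_split; apply/eq_bigr => g _.
rewrite -big_split; apply/eq_bigr => h _ /=.
by rewrite mcoeffD mulrDl monalgUD.
Qed.

Lemma galg_mulDr : right_distributive galg_mul +%R.
Proof.
move=> z x y.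
rewrite (galg_mulw (fsubset_refl (msupp z)) (msuppD_le x y)).
rewrite (galg_mulw (fsubset_refl (msupp z)) (fsubsetUl (msupp x) (msupp y))).
rewrite (galg_mulw (fsubset_refl (msupp z)) (fsubsetUr (msupp x) (msupp y))).
rewrite -big_split; apply/eq_bigr => g _.
rewrite -big_split; apply/eq_bigr => h _ /=.
by rewrite mcoeffD mulrDr monalgUD.
Qed.

Lemma galg_mul0l : left_zero 0 galg_mul.
Proof. by move=> x; rewrite /galg_mul msupp0 big_seq_fset0. Qed.

Lemma galg_mul0r : right_zero 0 galg_mul.
Proof.
by move=> x; rewrite /galg_mul big1 // => g _; rewrite msupp0 big_seq_fset0.
Qed.

Lemma galg_mul_suml (I : Type) (r : seq I) (F : I -> {malg k[G]}) y :
  galg_mul (\sum_(i <- r) F i) y = \sum_(i <- r) galg_mul (F i) y.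
Proof.
exact: (big_morph (galg_mul^~ y) (fun _ _ => galg_mulDl _ _ _) (galg_mul0l _)).
Qed.

Lemma galg_mul_sumr (I : Type) (r : seq I) (F : I -> {malg k[G]}) x :
  galg_mul x (\sum_(i <- r) F i) = \sum_(i <- r) galg_mul x (F i).
Proof.
exact: (big_morph (galg_mul x) (fun _ _ => galg_mulDr _ _ _) (galg_mul0r _)).
Qed.

Lemma galg_mulA : associative galg_mul.
Proof.
move=> x y z; rewrite [x]monalgE !galg_mul_suml; apply/eq_bigr => g _.
rewrite [y]monalgE galg_mul_suml !galg_mul_sumr galg_mul_suml.
apply/eq_bigr => h _; rewrite [z]monalgE !galg_mul_sumr; apply/eq_bigr => l _.
by rewrite !galg_mulUU mulrA mulgA.
Qed.

Lemma galg_mul1l : left_id galg_one galg_mul.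
Proof.
move=> x; rewrite [x]monalgE galg_mul_sumr; apply/eq_bigr => g _.
by rewrite galg_mulUU mul1r mul1g.
Qed.

Lemma galg_mul1r : right_id galg_one galg_mul.
Proof.
move=> x; rewrite [x]monalgE galg_mul_suml; apply/eq_bigr => g _.
by rewrite galg_mulUU mulr1 mulg1.
Qed.

Lemma galg_one_neq0 : galg_one != 0.
Proof. by rewrite monalgU_eq0 oner_eq0. Qed.

Lemma galg_scaleAl (c : k) x y : c *: galg_mul x y = galg_mul (c *: x) y.
Proof.
rewrite (galg_mulw (msuppZ_le c x) (fsubset_refl _)) scaler_sumr.
apply/eq_bigr => g _; rewrite scaler_sumr; apply/eq_bigr => h _.
by apply/malgP => l; rewrite !(mcoeffZ, mcoeffU) mulrnAr mulrA.
Qed.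

Lemma galg_scaleAr (c : k) x y : c *: galg_mul x y = galg_mul x (c *: y).
Proof.
rewrite (galg_mulw (fsubset_refl _) (msuppZ_le c y)) scaler_sumr.
apply/eq_bigr => g _; rewrite scaler_sumr; apply/eq_bigr => h _.
by apply/malgP => l; rewrite !(mcoeffZ, mcoeffU) mulrnAr mulrCA.
Qed.

End GroupAlgebraTheory.

(* An alias, because [{malg _[_]}] already has the library's product as its
   canonical one. *)
Definition group_algebra (k : fieldType) (G : groupType) : Type := {malg k[G]}.

Section GroupAlgebra.
Variables (k : fieldType) (G : groupType).

HB.instance Definition _ := GRing.Lmodule.copy (group_algebra k G) {malg k[G]}.

HB.instance Definition _ := GRing.Zmodule_isNzRing.Build (group_algebra k G)
  (@galg_mulA k G) (@galg_mul1l k G) (@galg_mul1r k G)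
  (@galg_mulDl k G) (@galg_mulDr k G) (@galg_one_neq0 k G).

HB.instance Definition _ := GRing.Lmodule_isLalgebra.Build k (group_algebra k G)
  (@galg_scaleAl k G).

HB.instance Definition _ := GRing.Lalgebra_isAlgebra.Build k (group_algebra k G)
  (@galg_scaleAr k G).

End GroupAlgebra.

Definition trinomial (k : fieldType) (G : groupType) (x : group_algebra k G) :
    Prop :=
  #|` msupp x| = 3%N.

Section Ideal.
Variable R : nzRingType.

Definition two_sided_ideal (I : set R) : Prop :=
  [/\ I 0, forall x y, I x -> I y -> I (x + y),
      forall a x, I x -> I (a * x) & forall a x, I x -> I (x * a)].

Definition ideal_generated_by (x : R) : set R :=
  smallest two_sided_ideal [set x].

Definition generates_improper_ideal (x : R) : Prop :=
  ideal_generated_by x = setT.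

End Ideal.

(* Main.v *)
Require Import Defs.
From mathcomp Require Import all_boot all_algebra finmap.
From mathcomp.multinomials Require Import monalg.
From mathcomp Require Import boolp classical_sets.

(** The group-theoretic half looks at the last nonabelian term [D] of the
derived series, whose derived subgroup [A] is abelian.  Take [x] and [y] in [D]
that do not commute, and let [c] be their commutator, so that [x ^ y = x * c].
If [x] commutes with [c], then [x] commutes with its conjugate [x ^ y <> x].
Otherwise [c ^ x <> c], and [c] and [c ^ x] are elements of [A], so they commute
([commuting_conjugate_solvable]).

For the trinomial, choose [g] and [t] such that [g] commutes with
[t * g * t^-1 <> g], and take [1 + t - t ^ g].  With [z := g^-1 * (t * g * t^-1)]
one has [t ^ g = z * t], so modulo the ideal generated by the trinomial
[t^-1 = z - 1].  As [g] commutes with [z], it commutes with [t^-1] modulo the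
ideal; hence [t ^ g = t] there, and the trinomial itself reduces to [1]
([commuting_conjugate_improper]). *)

Set Implicit Arguments.
Unset Strict Implicit.
Unset Printing Implicit Defensive.

Import GRing.Theory.

Section DerivedSeries.
Variable G : groupType.
Local Open Scope group_scope.
Local Open Scope classical_set_scope.

Implicit Types (H : set G) (x y g h : G).

Definition pairwise_commute H : Prop :=
  forall x y, H x -> H y -> commute x y.

Lemma mem_derived_subgroup H x y :
  H x -> H y -> derived_subgroup H [~ x, y].
Proof. by move=> Hx Hy K [_]; apply; exists x, y. Qed.

Lemma derived_subgroup_subgroup H : subgroup (derived_subgroup H).
Proof.
split=> [K [[]] //|x y Hx Hy K KP|x Hx K KP]; have [[_ KM KV] _] := KP.
- by apply: KM; [apply: Hx | apply: Hy].
- by apply: KV; apply: Hx.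
Qed.

Lemma derived_subgroup_sub H : subgroup H -> derived_subgroup H `<=` H.
Proof.
move=> sgH; apply: smallest_sub => // _ [x [y [Hx Hy ->]]].
have [_ HM HV] := sgH; rewrite commgEl /conjg.
by apply: (HM) (HM _ _ _ (HM _ _ _ _)) => //; apply: HV.
Qed.

Lemma derived_series_subgroup n : subgroup (derived_series n : set G).
Proof. by case: n => [|n] //; apply: derived_subgroup_subgroup. Qed.

Lemma last_nonabelian_derived n :
    ~ abelian_group G -> pairwise_commute (derived_series n) ->
  exists m, ~ pairwise_commute (derived_series m : set G) /\
            pairwise_commute (derived_series m.+1 : set G).
Proof.
move=> Gnab; elim: n => [abG|n IHn abS]; first by case: Gnab => x y; apply: abG.
by have [/IHn //|nab] := pselect (pairwise_commute (derived_series n : set G));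
  exists n.
Qed.

Lemma conjg_commgM g h : g ^ h = g * [~ g, h].
Proof. by rewrite commgEl mulVKg. Qed.

Lemma commuting_conjugate_solvable :
    ~ abelian_group G -> solvable_group G ->
  exists g h, commute g (g ^ h) /\ g ^ h <> g.
Proof.
move=> Gnab [n Dn].
have /(last_nonabelian_derived Gnab) [m [nabD abA]] :
    pairwise_commute (derived_series n : set G).
  by rewrite Dn => x y /= -> ->.
move/existsNP: nabD => [x /existsNP [y nab]].
move/not_implyP: nab => [Dx /not_implyP [Dy nxy]].
have Ac := mem_derived_subgroup Dx Dy.
have Dc := derived_subgroup_sub (@derived_series_subgroup m) Ac.
have [xc|nxc] := pselect (commute x [~ x, y]).
  exists x, y; split; last by move/conjg_fixP/commgP.
  by rewrite conjg_commgM; apply: commuteM.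
exists [~ x, y], x; split; last by move/conjg_fixP/commgP/commute_sym.
rewrite conjg_commgM; apply: commuteM => //.
by apply: abA => //; apply: mem_derived_subgroup.
Qed.

End DerivedSeries.

Section Trinomial.
Variables (k : fieldType) (G : groupType).
Local Open Scope ring_scope.

Implicit Types (g h t : G).

Definition galg_of g : group_algebra k G := << g >>.

Lemma galg_ofM g h : galg_of (g * h)%g = galg_of g * galg_of h.
Proof. by rewrite /galg_of -[RHS]/(galg_mul _ _) galg_mulUU mulr1. Qed.

Lemma galg_of1 : galg_of 1%g = 1.
Proof. by []. Qed.

Lemma galg_of_trinomial (g1 g2 g3 : G) :
    g1 != g2 -> g1 != g3 -> g2 != g3 ->
  trinomial (galg_of g1 + galg_of g2 - galg_of g3).
Proof.
move=> n12 n13 n23; rewrite /trinomial.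
suff -> : msupp (galg_of g1 + galg_of g2 - galg_of g3 : {malg k[G]})
          = (g1 |` [fset g2; g3])%fset.
  by rewrite cardfsU1 cardfs2 !inE (negbTE n12) (negbTE n13) n23.
apply/fsetP => h; rewrite -mcoeff_neq0 mcoeffB mcoeffD !mcoeffU !inE.
rewrite ![h == _]eq_sym.
have [<-|_] := eqVneq g1 h.
  rewrite (eq_sym g2) (negbTE n12) (eq_sym g3) (negbTE n13).
  by rewrite addr0 subr0 oner_eq0.
have [<-|_] := eqVneq g2 h.
  by rewrite (eq_sym g3) (negbTE n23) add0r subr0 oner_eq0.
by have [_|_] := eqVneq g3 h; rewrite !add0r oppr_eq0 ?oner_eq0 ?eqxx.
Qed.

(** With [t ^ g = z * t], the trinomial plus [(z - 1) * t] is [1], so it suffices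
that [z - 1] lies in the ideal.  Up to a unit it is the commutator of [g] with
[(1 + t - t ^ g) * t^-1 = t^-1 - (z - 1)], because [g] commutes with [z]. *)
Lemma commuting_conjugate_improper g t :
    commute g (g ^ t^-1)%g ->
  generates_improper_ideal (1 + galg_of t - galg_of (t ^ g)%g).
Proof.
move=> gtg; rewrite /generates_improper_ideal; set x := _ - _.
apply/seteqP; split=> // a _ I [[_ ID IMl IMr] /(_ x erefl) Ix].
have IB b c : I b -> I c -> I (b - c).
  by move=> Ib Ic; rewrite -[c]mul1r -mulNr; apply/ID/IMl.
pose z := (g^-1 * g ^ t^-1)%g.
have tgE : (t ^ g = z * t)%g.
  by rewrite /z /conjg invgK !mulgA mulgVK.
have gz : (g * z = z * g)%g.
  by apply: commuteM => //; apply: commuteV.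
pose y := x * galg_of t^-1%g.
have yE : y = galg_of t^-1%g + 1 - galg_of z.
  by rewrite /y mulrBl mulrDl mul1r -!galg_ofM tgE mulgV mulgK.
have Iy : I y by apply: IMr.
have com_gy : galg_of g * y - y * galg_of g
            = galg_of (g * t^-1)%g - galg_of (t^-1 * g)%g.
  rewrite yE mulrBr mulrBl mulrDr mulrDl mulr1 mul1r -!galg_ofM gz.
  by rewrite opprB addrA subrK opprD addrACA subrr addr0.
have Iz : I (galg_of z - 1).
  have -> : galg_of z - 1 =
      galg_of (g^-1 * t)%g * (galg_of g * y - y * galg_of g).
    rewrite com_gy mulrBr -!galg_ofM.
    by rewrite !mulgA mulgK mulVg galg_of1 -!mulgA /z /conjg invgK.
  by apply/IMl/IB; [apply: IMl | apply: IMr].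
suff I1 : I 1 by rewrite -[a]mulr1; apply: IMl.
suff -> : 1 = x + (galg_of z - 1) * galg_of t by apply/ID/IMr.
by rewrite /x tgE galg_ofM mulrBl mul1r addrA subrK addrK.
Qed.

End Trinomial.

Theorem corollary8 (k : fieldType) (G : groupType)
    (Gnonab : ~ abelian_group G) (Gsol : solvable_group G) :
  (exists g h : G, commute g (g ^ h)%g /\ (g ^ h)%g <> g) /\
  (exists x : group_algebra k G, trinomial x /\ generates_improper_ideal x).
Proof.
have [g [h [ggh ngh]]] := commuting_conjugate_solvable Gnonab Gsol.
split; first by exists g, h.
(* As [g ^ (h^-1)^-1] is [g ^ h], the trinomial is taken with [t := h^-1]. *)
exists (galg_of k 1 + galg_of k h^-1 - galg_of k (h^-1 ^ g))%R.
split; last first.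
  by rewrite galg_of1; apply: commuting_conjugate_improper; rewrite invgK.
have nhg : h^-1%g != (h^-1 ^ g)%g.
  apply/eqP => /esym/conjg_fixP/commgP/commute_sym/commuteV.
  by rewrite invgK => /commgP/conjg_fixP.
have nh1 : h^-1%g != 1%g by apply: contraNneq nhg => ->; rewrite conj1g.
by apply: galg_of_trinomial => //; rewrite eq_sym ?conjg_eq1.
Qed.
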